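(* Consider the following single-source status-update system. Time is slotted, $t=0,1,2,\ldots$. At each slot $t$ a buffer holds the $B$ most recent features $X_t,\ldots,X_{t-B+1}$. The $i$-th feature ($i=1,2,\ldots$) is submitted to the channel at slot $S_i$, is the feature $X_{S_i-b_i}$ with buffer position $b_i\in\{0,\ldots,B-1\}$, and is delivered at slot $D_i=S_i+T_i$, where the transmission times $T_i$ ($i=0,1,\ldots$) are i.i.d. positive-integer-valued with $1\le\mathbb E[T_i]<\infty$; transmissions are non-preemptive, so $D_i\le S_{i+1}$. Initially $S_0=0$, $D_0=T_0$ and $\Delta(0)$ is a finite constant. The age of information is $\Delta(t)=t-\max_i\{S_i-b_i:D_i\le t\}$. Let $\Pi$ be the set of causal, signal-agnostic policies $(f,g)$ with $f=(b_1,b_2,\ldots)$, $g=(S_1,S_2,\ldots)$ (decisions use only current and past information available at the scheduler, not the realization of the feature/target process; the scheduler knows $p$ and the distribution of $T_i$). Let $p:\{0,1,2,\ldots\}\to\mathbb R$ with $|p(\delta)|\le M$ for all $\delta$. Fix $b\in\{0,\ldots,B-1\}$ and $f_b=(b,b,\ldots)$, and consider $$\bar p_{b,opt}=\inf_{(f_b,g)\in\Pi}\limsup_{T\to\infty}\frac1T\mathbb E_{(f_b,g)}\Big[\sum_{t=0}^{T-1}p(\Delta(t))\Big].$$ Define $\gamma(\delta)=\inf_{\tau\in\{1,2,\ldots\}}\frac1\tau\sum_{k=0}^{\tau-1}\mathbb E[p(\delta+k+T_1)]$. For a threshold $\beta\in\mathbb R$, let $S_{i+1}(\beta)=\min\{t\in\mathbb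 Z: t\ge D_i(\beta),\ \gamma(\Delta(t))\ge\beta\}$, $D_i(\beta)=S_i(\beta)+T_i$, with all features taken from buffer position $b$, so that $\Delta(t)=t-S_i(\beta)+b$ for $D_i(\beta)\le t<D_{i+1}(\beta)$. Let $\beta_b$ be the unique root of $$\mathbb E\Big[\sum_{t=D_i(\beta_b)}^{D_{i+1}(\beta_b)-1}p(\Delta(t))\Big]-\beta_b\,\mathbb E\big[D_{i+1}(\beta_b)-D_i(\beta_b)\big]=0.$$ Then $g=(S_1(\beta_b),S_2(\beta_b),\ldots)$ is an optimal solution to the problem defining $\bar p_{b,opt}$, the optimal value is $$\bar p_{b,opt}=\frac{\mathbb E\big[\sum_{t=D_i(\beta_b)}^{D_{i+1}(\beta_b)-1}p(\Delta(t))\big]}{\mathbb E[D_{i+1}(\beta_b)-D_i(\beta_b)]},$$ and $\beta_b=\bar p_{b,opt}$. *)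

(* Defs.v *)
From HB Require Import structures.
From mathcomp Require Import all_boot all_order all_algebra.
From mathcomp Require Import all_classical all_reals all_analysis.
Set Implicit Arguments. Unset Strict Implicit. Unset Printing Implicit Defensive.
Import Order.TTheory GRing.Theory Num.Theory.
Local Open Scope ring_scope.
Local Open Scope classical_set_scope.

Section AoI.
Context {R : realType} {d : measure_display} {Omega : measurableType d}.
Variable (P : probability Omega R).

(** Sample-path dynamics of the system, given the transmission times
    [Tn i] and the waiting times [Zn i] (the policy decides S_{i+1} = D_i + Z_i).
    All features are taken from buffer position [b]. *)
Definition S_ (Tn Zn : nat -> nat) : nat -> nat :=
  fix S i := if i is j.+1 then (S j + Tn j + Zn j)%N else 0%N.

Definition D_ (Tn Zn : nat -> nat) (i : nat) : nat := (S_ Tn Zn i + Tn i)%N.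

(** Age: Delta(t) = t - max{S_i - b : D_i <= t}; before the first delivery
    the age is Delta(0) + t.  (Indices i > t never satisfy D_i <= t since T_i >= 1.) *)
Definition Delta_ (b Delta0 : nat) (Tn Zn : nat -> nat) (t : nat) : nat :=
  if [exists i : 'I_t.+1, (D_ Tn Zn i <= t)%N]
  then (t + b - \max_(i < t.+1 | (D_ Tn Zn i <= t)%N) S_ Tn Zn i)%N
  else (Delta0 + t)%N.

Definition Ex (X : Omega -> R) : \bar R := \int[P]_w (X w)%:E.

Definition iid_pmf (T : nat -> Omega -> nat) (q : nat -> R) : Prop :=
  (forall i k, measurable [set w | T i w = k]) /\
  forall (n : nat) (k : nat -> nat),
    P [set w | forall j, (j < n)%N -> T j w = k j] = (\prod_(j < n) q (k j))%:E.

(** causal (non-anticipative, possibly randomized) signal-agnostic policies with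
    fixed buffer position: the waiting times Z_i (decided at D_i) are random
    variables such that, given the history (T_0..T_i, Z_0..Z_i), the future
    transmission times T_{i+1}, T_{i+2}, ... are still i.i.d. with pmf q. *)
Definition causal_policy (T : nat -> Omega -> nat) (q : nat -> R)
    (Z : nat -> Omega -> nat) : Prop :=
  (forall i z, measurable [set w | Z i w = z]) /\
  forall (i m : nat) (k z u : nat -> nat),
    P ([set w | forall j, (j <= i)%N -> T j w = k j /\ Z j w = z j]
       `&` [set w | forall j, (j < m)%N -> T (i.+1 + j)%N w = u j])
    = (P [set w | forall j, (j <= i)%N -> T j w = k j /\ Z j w = z j]
      * (\prod_(j < m) q (u j))%:E)%E.

Definition avg_cost (p : nat -> R) (b Delta0 : nat) (T Z : nat -> Omega -> nat)
    : \bar R :=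
  limn_esup (fun n : nat =>
    ((n%:R^-1)%:E *
      Ex (fun w => (\sum_(t < n) p (Delta_ b Delta0 (T ^~ w) (Z ^~ w) t))%R))%E).

Definition pbar_opt (q p : nat -> R) (b Delta0 : nat) (T : nat -> Omega -> nat)
    : \bar R :=
  ereal_inf [set avg_cost p b Delta0 T Z | Z in causal_policy T q].

Definition gamma_ (p : nat -> R) (T : nat -> Omega -> nat) (delta : nat) : R :=
  inf [set (tau%:R^-1 * \sum_(k < tau) fine (Ex (fun w => p (delta + k + T 1%N w)%N)))
      | tau in [set tau : nat | (0 < tau)%N]].

(** threshold waiting time: the age at D_i is T_i + b, and
    S_{i+1}(beta) = min{ t >= D_i : gamma(Delta(t)) >= beta }, i.e.
    Z_i = min{ z : gamma(T_i + b + z) >= beta }  (0 if no such z: this case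
    is excluded by [beta_root] for every value T_i may take). *)
Definition thr_wait (p : nat -> R) (T : nat -> Omega -> nat) (b : nat) (beta : R)
    (t : nat) : nat :=
  match pselect (exists z, beta <= gamma_ p T (t + b + z)%N) with
  | left H => ex_minn (P := fun z => beta <= gamma_ p T (t + b + z)%N) H
  | right _ => 0%N
  end.

Definition thr_policy (p : nat -> R) (T : nat -> Omega -> nat) (b : nat) (beta : R)
    : nat -> Omega -> nat :=
  fun i w => thr_wait p T b beta (T i w).

Definition cycle_cost (p : nat -> R) (T : nat -> Omega -> nat) (b Delta0 : nat)
    (beta : R) (i : nat) (w : Omega) : R :=
  let Tn := T ^~ w in let Zn := thr_policy p T b beta ^~ w in
  \sum_(D_ Tn Zn i <= t < D_ Tn Zn i.+1) p (Delta_ b Delta0 Tn Zn t).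

Definition cycle_len (p : nat -> R) (T : nat -> Omega -> nat) (b : nat)
    (beta : R) (i : nat) (w : Omega) : R :=
  let Tn := T ^~ w in let Zn := thr_policy p T b beta ^~ w in
  (D_ Tn Zn i.+1 - D_ Tn Zn i)%N%:R.

(** beta is a root of the equation: the threshold times S_{i+1}(beta) are
    finite (for every possible value of T_i), the expectations are finite,
    and E[cycle cost] - beta E[cycle length] = 0 (for every i). *)
Definition beta_root (q p : nat -> R) (T : nat -> Omega -> nat) (b Delta0 : nat)
    (beta : R) : Prop :=
  [/\ forall t, 0 < q t -> exists z, beta <= gamma_ p T (t + b + z)%N,
      forall i, P.-integrable setT (fun w => (cycle_len p T b beta i w)%:E)
    & forall i, fine (Ex (cycle_cost p T b Delta0 beta i))
                - beta * fine (Ex (cycle_len p T b beta i)) = 0].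

End AoI.

(* Main.v *)
Require Import Defs.
From HB Require Import structures.
From mathcomp Require Import all_boot all_order all_algebra.
From mathcomp Require Import all_classical all_reals all_analysis.
From mathcomp Require Import measurable_realfun.
From mathcomp Require Import ring lra zify.
Set Implicit Arguments.
Unset Strict Implicit.
Unset Printing Implicit Defensive.
Import Order.TTheory GRing.Theory Num.Theory.
Import numFieldNormedType.Exports.
Local Open Scope ring_scope.
Local Open Scope classical_set_scope.

(** Subtract beta_b from the penalty p.  With age t + b at a delivery, waiting z
    slots costs in expectation [stage_cost t z] until the next delivery, and
    [stage_cost t (z+1) - stage_cost t z = E p(t + b + z + T) - beta_b].
    Choosing z is therefore a deterministic stopping problem, and gamma tells
    whether some continuation decreases the cost, so the threshold rule minimises
    [stage_cost t] for every t; being a root means that this minimum has mean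
    zero under t ~ T.

    S_i depends on the past of T_i only, so the stages submitted before slot n
    have nonnegative total expected excess cost, and zero excess cost under the
    threshold rule.  This total differs from the excess cost of the slots before
    n by at most a constant plus a multiple of sum_{m < n} E[(L - m)^+] with L
    integrable: the S_i are distinct, and the stage straddling n exceeds it by at
    most L - (n - S_i).  The sum is o(n) by dominated convergence and Cesaro.  For a
    general policy, whose waiting times need not be integrable, the waiting of
    the straddling stage is first cut off at slot n. *)

(** * Integrals of discrete random variables *)

Section Discrete.
Context {R : realType} {d : measure_display} {Omega : measurableType d}.
Variable P : probability Omega R.

(** Measurability is stated on fibres, the form in which [iid_pmf] and [causal_policy] provide it;
    no sigma-algebra on [C] has to be chosen. *)
Definition fibre_measurable (C : Type) (X : Omega -> C) :=
  forall c, measurable [set w | X w = c].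

Lemma fibre_measurable_set (C : countType) (X : Omega -> C) (A : set C) :
  fibre_measurable X -> measurable [set w | A (X w)].
Proof.
move=> mX.
have -> : [set w | A (X w)] =
    \bigcup_n [set w | A (X w) /\ pickle (X w) = n].
  by apply/seteqP; split => [w Aw|w [n _ [Aw _]]] //=; exists (pickle (X w)).
apply: bigcupT_measurable => n.
case E : (pickle_inv n : option C) => [c|]; last first.
  rewrite (_ : [set w | _] = set0) //; apply/seteqP; split => // w [_ hn] /=.
  by move: E; rewrite -hn pickleK_inv.
have [Ac|nAc] := pselect (A c).
  rewrite (_ : [set w | _] = [set w | X w = c]); first exact: mX.
  apply/seteqP; split => w /=.
    by case=> _ hn; move: E; rewrite -hn pickleK_inv => -[].
  by move=> ->; split => //; have := @pickle_invK C n; rewrite /ocancel E.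
rewrite (_ : [set w | _] = set0) //; apply/seteqP; split => // w [Aw hn] /=.
by apply: nAc; move: E; rewrite -hn pickleK_inv => -[<-].
Qed.

(** Every function of a countable-valued variable is again measurable, since its fibres are
    countable unions of fibres of [X]. *)
Lemma fibre_measurable_comp (C : countType) (C' : Type) (X : Omega -> C)
    (f : C -> C') :
  fibre_measurable X -> fibre_measurable (fun w => f (X w)).
Proof. by move=> mX c; exact: (fibre_measurable_set (fun x => f x = c) mX). Qed.

Lemma fibre_measurable_pair (C C' : countType) (X : Omega -> C) (Y : Omega -> C') :
  fibre_measurable X -> fibre_measurable Y -> fibre_measurable (fun w => (X w, Y w)).
Proof.
move=> mX mY [a c].
rewrite (_ : [set w | _] = [set w | X w = a] `&` [set w | Y w = c]).
  exact: measurableI.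
by apply/seteqP; split => w /= [-> ->].
Qed.

Lemma measurable_fun_discrete (C : countType) (X : Omega -> C)
    (f : C -> \bar R) (D : set Omega) :
  fibre_measurable X -> measurable D -> measurable_fun D (fun w => f (X w)).
Proof.
move=> mX mD _ A mA; apply: measurableI => //.
exact: (fibre_measurable_set (f @^-1` A) mX).
Qed.

Lemma ge0_integral_discrete (N : Omega -> nat) (A : set Omega)
    (f : nat -> \bar R) :
  measurable A -> fibre_measurable N -> (forall n, 0 <= f n)%E ->
  (\int[P]_(w in A) f (N w) =
   \sum_(0 <= n <oo) f n * P (A `&` [set w | N w = n]))%E.
Proof.
move=> mA mN f0.
have mF n : measurable (A `&` [set w | N w = n]) by apply: measurableI.
have AE : A = \bigcup_n (A `&` [set w | N w = n]).
  by apply/seteqP; split => [w Aw|w [n _ []]] //; exists (N w).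
rewrite {1}AE ge0_integral_bigcup //.
- apply: eq_eseriesr => n _; rewrite -integral_cst //.
  by apply: eq_integral => w; rewrite inE => -[_ /= ->].
- by rewrite -AE; exact: (measurable_fun_discrete f mN).
- by move=> i j _ _ [w [[_ <-] [_ <-]]].
Qed.

(** Tonelli for independent variables, [Y] being replaced by a copy [Y0]. The product hypothesis
    carries both the independence of [X] and [Y] and the equality in law of [Y] and [Y0]. Splitting
    on the values of [Y], then of [X], turns each side into the same double series up to order of
    summation. *)
Lemma ge0_integral_independent (C : countType) (X : Omega -> C)
    (Y Y0 : Omega -> nat) (F : C -> nat -> \bar R) :
  fibre_measurable X -> fibre_measurable Y -> fibre_measurable Y0 ->
  (forall c k, P ([set w | X w = c] `&` [set w | Y w = k]) =
     P [set w | X w = c] * P [set w | Y0 w = k])%E ->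
  (forall c k, 0 <= F c k)%E ->
  (\int[P]_w F (X w) (Y w) = \int[P]_w \int[P]_w' F (X w) (Y0 w'))%E.
Proof.
move=> mX mY mY0 XY F0.
(* [F] is carried over to the codes of [C], with value 0 at numbers that code nothing, so that both
   series run over [nat]. *)
pose F' n k : \bar R := if (pickle_inv n : option C) is Some c then F c k else 0%E.
have F'0 n k : (0 <= F' n k)%E by rewrite /F'; case: (pickle_inv n : option C).
have F'E w k : F (X w) k = F' (pickle (X w)) k by rewrite /F' pickleK_inv.
have mN : fibre_measurable (fun w => pickle (X w)) by exact: fibre_measurable_comp.
have mTY k : measurable (setT `&` [set w | Y w = k]) by rewrite setTI; exact: mY.
transitivity (\sum_(0 <= k <oo) \int[P]_(w in [set w | Y w = k]) F' (pickle (X w)) k)%E.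
  have TE : [set: Omega] = \bigcup_k [set w | Y w = k].
    by apply/seteqP; split => w //= _; exists (Y w).
  rewrite {1}TE ge0_integral_bigcup //.
  - apply: eq_eseriesr => k _.
    by apply: eq_integral => w; rewrite inE => /= ->.
  - rewrite -TE; apply: (@measurable_fun_discrete _
      (fun w => (X w, Y w)) (fun c => F c.1 c.2)) => //.
    exact: fibre_measurable_pair.
  - by move=> i j _ _ [w [/= <- <-]].
transitivity (\sum_(0 <= k <oo) \sum_(0 <= n <oo)
   F' n k * (P [set w | pickle (X w) = n] * P [set w | Y0 w = k]))%E.
  apply: eq_eseriesr => k _; rewrite (@ge0_integral_discrete (fun w => pickle (X w)) _ (F'^~ k)) //.
  apply: eq_eseriesr => n _; rewrite setIC /F'.
  case E : (pickle_inv n : option C) => [c|]; last by rewrite !mul0e.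
  rewrite (_ : [set w | pickle (X w) = n] = [set w | X w = c]) ?XY //.
  apply/seteqP; split => w /=.
    by move=> hn; move: E; rewrite -hn pickleK_inv => -[].
  by move=> ->; have := @pickle_invK C n; rewrite /ocancel E.
rewrite nneseries_interchange; last by move=> i j; rewrite !mule_ge0.
under [RHS]eq_integral do under eq_integral do rewrite F'E.
rewrite (@ge0_integral_discrete (fun w => pickle (X w)) _ (fun n => \int[P]_w' F' n (Y0 w')))%E //; last first.
  by move=> n; apply: integral_ge0.
apply: eq_eseriesr => n _; rewrite (@ge0_integral_discrete Y0 setT (F' n)) // setTI muleC.
have /fineK <- : P [set w | pickle (X w) = n] \is a fin_num.
  by rewrite fin_num_measure //; exact: mN.
rewrite -nneseriesZl; last by move=> k _; rewrite mule_ge0.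
by apply: eq_eseriesr => k _; rewrite setTI muleCA.
Qed.

End Discrete.

(** * Real expectations and independence *)

Section RealExpectation.
Context {R : realType} {d : measure_display} {Omega : measurableType d}.
Variable P : probability Omega R.
Local Notation E := (Rintegral P setT).
Local Notation integ f := (P.-integrable setT (EFin \o f)).
Implicit Types f g : Omega -> R.

Lemma E_EFin f : integ f -> (\int[P]_w (f w)%:E = (E f)%:E)%E.
Proof. by move=> fi; rewrite /Rintegral fineK // integrable_fin_num. Qed.

Lemma eq_E f g : f =1 g -> E f = E g.
Proof. by move=> fg; apply: eq_Rintegral => w _; apply: fg. Qed.

Lemma eq_integ f g : f =1 g -> integ f -> integ g.
Proof. by move=> fg; apply: eq_integrable => // w _ /=; rewrite fg. Qed.

Lemma integ_cst (c : R) : integ (fun=> c).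
Proof. exact: finite_measure_integrable_cst. Qed.

Lemma E_cst (c : R) : E (fun=> c) = c.
Proof. by rewrite Rintegral_cst //= probability_setT mulr1. Qed.

Lemma integD f g : integ f -> integ g -> integ (fun w => f w + g w).
Proof. by move=> fi gi; apply: (integrableD measurableT fi gi). Qed.

Lemma integB f g : integ f -> integ g -> integ (fun w => f w - g w).
Proof. by move=> fi gi; apply: (integrableB measurableT fi gi). Qed.

Lemma integZ (c : R) f : integ f -> integ (fun w => c * f w).
Proof. by move=> fi; apply: (integrableZl measurableT c fi). Qed.

Lemma integ_sum (I : Type) (s : seq I) (F : I -> Omega -> R) :
  (forall i, integ (F i)) -> integ (fun w => \sum_(i <- s) F i w).
Proof.
move=> Fi; elim: s => [|i s IH].
  by apply: eq_integ (integ_cst 0) => w; rewrite big_nil.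
by apply: eq_integ (integD (Fi i) IH) => w; rewrite big_cons.
Qed.

Lemma E_sum (I : Type) (s : seq I) (F : I -> Omega -> R) :
  (forall i, integ (F i)) ->
  E (fun w => \sum_(i <- s) F i w) = \sum_(i <- s) E (F i).
Proof.
move=> Fi; elim: s => [|i s IH].
  by rewrite big_nil -[RHS](E_cst 0); apply: eq_E => w; rewrite big_nil.
rewrite big_cons -IH -RintegralD //; last exact: integ_sum.
by apply: eq_E => w; rewrite big_cons.
Qed.

(** A null set may be discarded on both sides. Positivity of the transmission times and existence of
    the threshold hold only off such a set. *)
Lemma le_E_ae f g (N : set Omega) : measurable N -> P N = 0%E ->
  integ f -> integ g -> (forall w, ~ N w -> f w <= g w) -> E f <= E g.
Proof.
move=> mN N0 fi gi fg.
rewrite /Rintegral (negligible_integral mN measurableT fi N0).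
rewrite (negligible_integral mN measurableT gi N0).
apply: le_Rintegral => //.
- exact: measurableD.
- by apply: integrableS fi => //; exact: measurableD.
- by apply: integrableS gi => //; exact: measurableD.
- by move=> w [_]; exact: fg.
Qed.

Lemma le_E f g : integ f -> integ g -> (forall w, f w <= g w) -> E f <= E g.
Proof. by move=> fi gi fg; apply: le_Rintegral. Qed.

Lemma integ_discrete (C : countType) (X : Omega -> C) (f : C -> R) g :
  fibre_measurable X -> integ g -> (forall w, `|f (X w)| <= g w) ->
  integ (fun w => f (X w)).
Proof.
move=> mX gi fg; apply: le_integrable gi => //.
  exact: (measurable_fun_discrete (fun c => (f c)%:E) mX).
by move=> w _; rewrite lee_fin (le_trans (fg w)) // ler_norm.
Qed.

(** * Integrating out a variable independent of the past *)

Section Independent.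
Variables (C : countType) (X : Omega -> C) (Y Y0 : Omega -> nat).
Hypothesis mX : fibre_measurable X.
Hypothesis mY : fibre_measurable Y.
Hypothesis mY0 : fibre_measurable Y0.
Hypothesis XY : (forall c k, P ([set w | X w = c] `&` [set w | Y w = k]) =
     P [set w | X w = c] * P [set w | Y0 w = k])%E.

Lemma eq_law_ge0 (D : nat -> \bar R) : (forall k, 0 <= D k)%E ->
  (\int[P]_w D (Y w) = \int[P]_w D (Y0 w))%E.
Proof.
move=> D0; rewrite (ge0_integral_independent (F := fun _ k => D k) mX mY mY0 XY) //.
by rewrite integral_cst //= probability_setT mule1.
Qed.

Lemma integ_eq_law (D : nat -> R) :
  integ (fun w => D (Y0 w)) -> integ (fun w => D (Y w)).
Proof.
move=> /integrableP[_ Dfin]; apply/integrableP; split.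
  exact: (measurable_fun_discrete (fun c => (D c)%:E) mY).
by rewrite (eq_law_ge0 (D := fun k => `|(D k)%:E|%E)).
Qed.

Lemma E_independent_ge0 (F : C -> nat -> R) :
  (forall c k, 0 <= F c k) -> integ (fun w => F (X w) (Y w)) ->
  (forall c, integ (fun w => F c (Y0 w))) ->
  integ (fun w => E (fun w' => F (X w) (Y0 w'))) /\
  E (fun w => F (X w) (Y w)) = E (fun w => E (fun w' => F (X w) (Y0 w'))).
Proof.
move=> F0 iF iF0.
have H := ge0_integral_independent (F := fun c k => (F c k)%:E) mX mY mY0 XY (fun c k => F0 c k).
have G0 w : 0 <= E (fun w' => F (X w) (Y0 w')) by apply: Rintegral_ge0.
have H' : (\int[P]_w (F (X w) (Y w))%:E = \int[P]_w (E (fun w' => F (X w) (Y0 w')))%:E)%E.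
  by rewrite H; apply: eq_integral => w _; rewrite -E_EFin.
split; last by rewrite /Rintegral H'.
apply/integrableP; split.
  exact: (measurable_fun_discrete (fun c => (E (fun w' => F c (Y0 w')))%:E) mX).
under eq_integral do rewrite /= ger0_norm //.
by rewrite -H' E_EFin // ltry.
Qed.

(** The signed version. Adding the dominating function [A c + D k] makes [F] nonnegative; the
    nonnegative case is applied to the shifted function and to the shift itself, and the two
    identities are subtracted. *)
Lemma E_independent (F : C -> nat -> R) (A : C -> R) (D : nat -> R) :
  (forall c k, `|F c k| <= A c + D k) ->
  integ (fun w => A (X w)) -> integ (fun w => D (Y0 w)) ->
  [/\ integ (fun w => F (X w) (Y w)),
      forall c, integ (fun w => F c (Y0 w)),
      integ (fun w => E (fun w' => F (X w) (Y0 w'))) &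
      E (fun w => F (X w) (Y w)) = E (fun w => E (fun w' => F (X w) (Y0 w')))].
Proof.
move=> FAD iA iD.
have iDY := integ_eq_law iD.
have iAD : integ (fun w => A (X w) + D (Y w)) by exact: integD.
have iF : integ (fun w => F (X w) (Y w)).
  exact: (integ_discrete (f := fun c => F c.1 c.2) (fibre_measurable_pair mX mY) iAD).
have iAD0 c : integ (fun w => A c + D (Y0 w)) by apply: integD => //; exact: integ_cst.
have iF0 c : integ (fun w => F c (Y0 w)).
  exact: (integ_discrete (f := F c) mY0 (iAD0 c)).
have S0 c k : 0 <= F c k + (A c + D k).
  by have := FAD c k; rewrite ler_norml => /andP[]; lra.
have [iS ES] := E_independent_ge0 S0 (integD iF iAD) (fun c => integD (iF0 c) (iAD0 c)).
have AD0 c k : 0 <= A c + D k by apply: le_trans (FAD c k).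
have [iS' ES'] := E_independent_ge0 AD0 iAD iAD0.
have SE c : E (fun w' => F c (Y0 w') + (A c + D (Y0 w')))
    = E (fun w' => F c (Y0 w')) + E (fun w' => A c + D (Y0 w')).
  by rewrite RintegralD.
have iG : integ (fun w => E (fun w' => F (X w) (Y0 w'))).
  have := integB iS iS'; apply: eq_integ => w.
  by rewrite -[RHS](addrK (E (fun w' => A (X w) + D (Y0 w')))) -SE.
split=> //.
apply: (addIr (E (fun w => A (X w) + D (Y w)))).
rewrite -RintegralD // ES ES' -RintegralD //.
by apply: eq_E => w; exact: SE.
Qed.

End Independent.

(** Dominated convergence: the integrand is at most [L] and vanishes at each point once [m] reaches
    [L w]. *)
Lemma cvg_E_subn (L : Omega -> nat) : fibre_measurable L ->
  integ (fun w => (L w)%:R) ->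
  (E (fun w => (L w - m)%:R)) @[m --> \oo] --> 0.
Proof.
move=> mL iL.
have iLm m : integ (fun w => (L w - m)%:R).
  apply: (integ_discrete (f := fun k => (k - m)%:R) mL iL) => w.
  by rewrite ger0_norm // ler_nat leq_subr.
have := @dominated_cvg _ _ _ P setT measurableT (fun m w => (L w - m)%:R%:E)
  (cst 0%E) (fun w => (L w)%:R%:E).
rewrite integral_cst // mul0e => H.
apply/fine_cvg; apply: H => //.
- move=> m; exact: (measurable_fun_discrete (fun k => (k - m)%:R%:E) mL).
- move=> w _; apply: cvg_near_cst; exists (L w) => // m /=.
  by rewrite -subn_eq0 => /eqP ->.
- by move=> m w _; rewrite lee_fin ger0_norm // ler_nat leq_subr.
Qed.

Lemma cvg_mean_E_subn (L : Omega -> nat) : fibre_measurable L ->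
  integ (fun w => (L w)%:R) ->
  n%:R^-1 * (\sum_(0 <= m < n) E (fun w => (L w - m)%:R)) @[n --> \oo] --> 0.
Proof.
move=> mL iL; have := cesaro (cvg_E_subn mL iL).
(* The mean in [cesaro] divides the first n+1 terms by n+1, hence the shift by one. *)
by rewrite /arithmetic_mean => H; rewrite -cvg_shiftS.
Qed.

End RealExpectation.

(** * Sample paths *)

Section Path.
Variables Tn Zn : nat -> nat.
Local Notation S := (S_ Tn Zn).
Local Notation D := (D_ Tn Zn).

Lemma S_mono i j : (i <= j)%N -> (S i <= S j)%N.
Proof.
move=> ij; rewrite -(subnKC ij); elim: (j - i)%N => [|k IH]; rewrite ?addn0 //.
by rewrite addnS (leq_trans IH) //= -addnA leq_addr.
Qed.

Lemma D_leS i j : (i < j)%N -> (D i <= S j)%N.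
Proof. by move=> ij; apply: leq_trans (S_mono ij); rewrite /D_ /= leq_addr. Qed.

Lemma D_mono i j : (i <= j)%N -> (D i <= D j)%N.
Proof.
rewrite leq_eqVlt => /orP[/eqP -> //|/D_leS Dij].
by rewrite (leq_trans Dij) // leq_addr.
Qed.

Lemma D_succ i : D i.+1 = (D i + (Zn i + Tn i.+1))%N.
Proof. by rewrite /D_ /=; lia. Qed.

(** As [D_] and [S_] are monotone, [i] is the latest delivered feature. The age only searches
    indices up to [t], so [i <= t] is assumed; it follows later from positivity of the transmission
    times. *)
Lemma Delta_cycle b Delta0 i t : (i <= t)%N -> (D i <= t < D i.+1)%N ->
  Delta_ b Delta0 Tn Zn t = (t + b - S i)%N.
Proof.
move=> it /andP[Dit tDi].
have it1 : (i < t.+1)%N by [].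
rewrite /Delta_ ifT; last by apply/existsP; exists (Ordinal it1).
congr (_ - _)%N; apply/eqP; rewrite eqn_leq; apply/andP; split; last first.
  exact: (@leq_bigmax_cond _ _ (fun j : 'I_t.+1 => S j) (Ordinal it1)).
apply/bigmax_leqP => j Djt; apply: S_mono.
by rewrite leqNgt; apply/negP => /D_mono; lia.
Qed.

(** Each term is [[S i < n] - [S i.+1 < n]], so the sum telescopes. *)
Lemma sum_last_submission (R : realDomainType) n N :
  \sum_(i < N) (S i < n <= S i.+1)%N%:R <= 1 :> R.
Proof.
have -> : \sum_(i < N) (S i < n <= S i.+1)%N%:R = (S 0 < n)%:R - (S N < n)%:R :> R.
  elim: N => [|N IH]; first by rewrite big_ord0 subrr.
  rewrite big_ord_recr /= IH leqNgt; have := S_mono (leqnSn N) => /=.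
  case: (ltnP (S N + Tn N + Zn N) n) => [lt1 le1|ge1 _] /=.
    by rewrite (leq_ltn_trans le1 lt1) addr0.
  by case: (ltnP (S N) n) => _ /=; rewrite ?subr0 ?subrK ?addr0.
by case: (_ < _)%N; case: (_ < _)%N; rewrite ?subrr ?subr0 ?sub0r ?lerN10 ?ler01 // lerN10.
Qed.

(** * Splitting the cost of a finite horizon into cycles *)

Section CycleCost.
Context {R : realType}.
Variables (b Delta0 : nat) (r : nat -> R).
Local Notation Delta := (Delta_ b Delta0 Tn Zn).

(** The wait [w] may be shorter than [Zn i]: this is the stage cut off at the horizon. *)
Definition partial_cycle i w : R := \sum_(k < w + Tn i.+1) r (Tn i + b + k).

Lemma partial_cycleE i w : (i <= D i)%N -> (w <= Zn i)%N ->
  \sum_(D i <= t < D i + (w + Tn i.+1)) r (Delta t) = partial_cycle i w.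
Proof.
move=> iD wZ; rewrite -[X in \sum_(X <= _ < _) _]add0n big_addn addKn big_mkord.
apply: eq_bigr => k _; congr r.
rewrite (@Delta_cycle _ _ i); first by rewrite /D_; lia.
  by rewrite (leq_trans iD) // leq_addl.
by rewrite D_succ; have := ltn_ord k; lia.
Qed.

Hypothesis Tpos : forall j, (0 < Tn j)%N.

Lemma S_ltmono i j : (i < j)%N -> (S i < S j)%N.
Proof. by move=> /D_leS; apply: leq_trans; rewrite /D_ -addn1 leq_add2l. Qed.

Lemma S_ge i : (i <= S i)%N.
Proof. by elim: i => // i IH; apply: leq_ltn_trans IH (S_ltmono _). Qed.

Lemma sum_cycles K :
  \sum_(i < K) partial_cycle i (Zn i) = \sum_(D 0 <= t < D K) r (Delta t).
Proof.
elim: K => [|K IH]; first by rewrite big_ord0 big_geq.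
rewrite big_ord_recr /= IH -partial_cycleE //; last first.
  by rewrite (leq_trans (S_ge K)) // leq_addr.
by rewrite -D_succ -big_cat_nat //; apply: D_mono.
Qed.

(** The [S i] below [n] are distinct, so the left side sums [phi] over distinct points of 1, ..., n;
    as [phi] decreases, each point may be lowered by one. *)
Lemma sum_residual (phi : nat -> R) n N :
  (forall m, 0 <= phi m) -> (forall m, phi m.+1 <= phi m) ->
  \sum_(i < N) (S i < n)%:R * phi (n - S i)%N <= \sum_(0 <= m < n) phi m.
Proof.
move=> phi0 phi_dec.
have sum_le a c : (a <= c)%N ->
    \sum_(0 <= s < a) phi (n - s)%N <= \sum_(0 <= s < c) phi (n - s)%N.
  move=> ac; rewrite (@big_cat_nat _ _ _ a 0%N c) //= lerDl.
  exact: sumr_ge0.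
(* The submission times of index below [N] lie below [S N], which leaves room for the term at [S N]
   in the induction. *)
have partial : \sum_(i < N) (S i < n)%:R * phi (n - S i)%N <=
    \sum_(0 <= s < minn n (S N)) phi (n - s)%N.
  elim: N => [|N IH]; first by rewrite big_ord0 sumr_ge0.
  rewrite big_ord_recr /=.
  have SN : (S N < S N.+1)%N by exact: S_ltmono.
  case: ltnP => Sn; last first.
    rewrite mul0r addr0 (le_trans IH) //; apply: sum_le.
    by rewrite leq_min geq_minl (leq_trans (geq_minr _ _)) // ltnW.
  rewrite mul1r (le_trans (lerD IH (lexx _))) //.
  rewrite (minn_idPr (ltnW Sn)) -big_nat_recr //=; apply: sum_le.
  by rewrite leq_min Sn.
apply: (le_trans partial); apply: (le_trans (sum_le _ n (geq_minl _ _))).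
(* Reversing the order turns [n - s] into [m.+1], and [phi m.+1 <= phi m]. *)
rewrite big_nat_rev /= add0n; apply: ler_sum_nat => m /andP[_ mn].
by rewrite (_ : n - (n - m.+1) = m.+1)%N //; lia.
Qed.

(** [S j >= j] makes the submission times pass [n]; the same bound gives [K <= S K < n], so sums
    over indices below [n] contain every stage that matters. *)
Lemma last_submission n : (0 < n)%N ->
  exists2 K, (K < n)%N & (S K < n <= S K.+1)%N.
Proof.
move=> n0; have ex : exists j, (n <= S j)%N by exists n; exact: S_ge.
case: (ex_minnP ex) => -[|K] nK minK; first by move: nK => /=; lia.
have SK : (S K < n)%N by rewrite ltnNge; apply/negP => /minK; lia.
by exists K; rewrite ?SK //; apply: leq_ltn_trans (S_ge K) SK.
Qed.

(** [W i] is the possibly cut-off wait and [e i] bounds its end, counted from S_i. *)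
Lemma cost_vs_cycles (C : R) (n : nat) (W e : nat -> nat) :
  (forall k, `|r k| <= C) -> (0 < n)%N ->
  (forall i, (W i <= Zn i)%N) ->
  (forall i, (S i.+1 < n)%N -> W i = Zn i) ->
  (forall i, (S i < n <= S i.+1)%N ->
    (n <= S i + Tn i + W i <= n + (e i - (n - S i)))%N) ->
  `|\sum_(t < n) r (Delta t)
     - \sum_(i < n) (S i < n)%:R * partial_cycle i (W i)|
  <= C * ((Tn 0)%:R + \sum_(i < n) (S i < n <= S i.+1)%:R * (Tn i.+1)%:R
        + \sum_(i < n) (S i < n)%:R * (e i - (n - S i))%:R).
Proof.
move=> rC n0 WZ WE We.
have C0 : 0 <= C by apply: le_trans (rC 0%N).
have [K Kn /andP[SKn nSK]] := last_submission n0.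
have SltK i : (S i < n)%N = (i < K.+1)%N.
  apply/idP/idP => [Sin|]; last by rewrite ltnS => /S_mono; lia.
  by rewrite ltnNge; apply/negP => /S_mono; lia.
(* The indices with [S i < n] are those up to [K], and only stage [K] may be cut off, so the cycles
   concatenate to the slots from [D 0] to the end of stage [K]. *)
have cycE : \sum_(i < n) (S i < n)%:R * partial_cycle i (W i) =
    \sum_(D 0 <= t < D K + (W K + Tn K.+1)) r (Delta t).
  transitivity (\sum_(0 <= i < K.+1) partial_cycle i (W i)).
    rewrite -(big_mkord xpredT (fun i => (S i < n)%:R * partial_cycle i (W i))).
    rewrite (@big_cat_nat _ _ _ K.+1) //= [X in _ + X]big_nat_cond [X in _ + X]big1 ?addr0.
      by apply: eq_big_nat => i /andP[_ iK]; rewrite SltK iK mul1r.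
    by move=> i /andP[/andP[Ki _] _]; rewrite SltK ltnNge Ki mul0r.
  rewrite big_mkord big_ord_recr /= (eq_bigr (fun i : 'I_K => partial_cycle i (Zn i))).
    rewrite sum_cycles -partial_cycleE // -?big_cat_nat ?leq_addr ?D_mono //.
    by rewrite (leq_trans (S_ge K)) // leq_addr.
  by move=> i _; rewrite WE // SltK ltnS.
have /andP[We1 We2] := We K (introT andP (conj SKn nSK)).
pose N := (D K + (W K + Tn K.+1))%N.
have nN : (n <= N)%N by rewrite /N /D_; lia.
have D0N : (D 0 <= N)%N by rewrite (leq_trans (D_mono (leq0n K))) // leq_addr.
have normC a c : `|\sum_(a <= t < c) r (Delta t)| <= C * (c - a)%:R.
  rewrite (le_trans (ler_norm_sum _ _ _)) // mulr_natr -sumr_const_nat.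
  exact: ler_sum.
(* What remains is the stretch before the first delivery and the overshoot of stage [K] past [n]. *)
have -> : \sum_(t < n) r (Delta t) - \sum_(i < n) (S i < n)%:R * partial_cycle i (W i)
   = \sum_(0 <= t < D 0) r (Delta t) - \sum_(n <= t < N) r (Delta t).
  rewrite cycE -(big_mkord xpredT (fun t => r (Delta t))).
  have := @big_cat_nat _ _ +%R n 0%N N xpredT (fun t => r (Delta t)) (leq0n n) nN.
  have := @big_cat_nat _ _ +%R (D 0) 0%N N xpredT (fun t => r (Delta t)) (leq0n _) D0N.
  by move=> /= -> /eqP; rewrite -/N; move=> /eqP; lra.
rewrite (le_trans (ler_normB _ _)) // (le_trans (lerD (normC _ _) (normC _ _))) //.
rewrite -mulrDr ler_wpM2l // -addrA subn0 {1}/D_ add0n lerD2l.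
have le1 : (Tn K.+1)%:R <= \sum_(i < n) (S i < n <= S i.+1)%:R * (Tn i.+1)%:R :> R.
  by rewrite (bigD1 (Ordinal Kn)) //= SKn nSK mul1r lerDl sumr_ge0.
have le2 : (e K - (n - S K))%:R <= \sum_(i < n) (S i < n)%:R * (e i - (n - S i))%:R :> R.
  by rewrite (bigD1 (Ordinal Kn)) //= SKn mul1r lerDl sumr_ge0.
apply: le_trans (lerD le1 le2); rewrite -natrD ler_nat /N /D_; lia.
Qed.

End CycleCost.
End Path.

(** * Causal policies *)

Section PathExtensionality.
Variables (T T' Z Z' : nat -> nat) (N : nat).
Hypothesis agree : forall j, (j < N)%N -> T j = T' j /\ Z j = Z' j.

(** This makes path quantities functions of a finite list of pairs, hence of a countable-valued
    variable, as the independence lemmas require. *)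
Lemma eq_S i : (i <= N)%N -> S_ T Z i = S_ T' Z' i.
Proof.
elim: i => // i IH iN /=; rewrite IH; last exact: ltnW.
by have [-> ->] := agree iN.
Qed.

Lemma eq_D i : (i < N)%N -> D_ T Z i = D_ T' Z' i.
Proof. by move=> iN; rewrite /D_ eq_S 1?ltnW //; have [-> _] := agree iN. Qed.

Lemma eq_Delta b Delta0 t : (t < N)%N ->
  Delta_ b Delta0 T Z t = Delta_ b Delta0 T' Z' t.
Proof.
move=> tN; have DE (i : 'I_t.+1) : D_ T Z i = D_ T' Z' i.
  by apply: eq_D; apply: leq_trans tN.
rewrite /Delta_; under eq_existsb do rewrite DE.
congr (if _ then (_ - _)%N else _).
by apply: eq_big => i; rewrite ?DE // => _; apply: eq_S; apply: leq_trans (ltnW _) tN.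
Qed.

End PathExtensionality.

Section Stochastic.
Context {R : realType} {d : measure_display} {Omega : measurableType d}.
Variable P : probability Omega R.
Variables (q : nat -> R) (T : nat -> Omega -> nat).
Hypothesis iid : iid_pmf P T q.
Local Notation E := (Rintegral P setT).
Local Notation integ f := (P.-integrable setT (EFin \o f)).

Lemma fibre_T i : fibre_measurable (T i).
Proof. exact: iid.1. Qed.

Lemma law_T0 k : P [set w | T 0%N w = k] = (q k)%:E.
Proof.
have := iid.2 1%N (fun=> k); rewrite big_ord_recl big_ord0 mulr1 => <-.
congr (P _); apply/seteqP; split => w /=; last exact.
by move=> Tk [|j].
Qed.

(** The history event is empty if the prescribed waits disagree with [zeta], and otherwise involves
    the transmission times only, so the product law applies. *)
Lemma causal_fun (zeta : nat -> nat) : causal_policy P T q (fun i w => zeta (T i w)).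
Proof.
split=> [i z|i m k z u].
  exact: (fibre_measurable_comp zeta (fibre_T i)).
have [zE|zNE] := pselect (forall j, (j <= i)%N -> zeta (k j) = z j); last first.
  rewrite (_ : [set w | forall j, (j <= i)%N -> _] = set0).
    by rewrite set0I !measure0 mul0e.
  apply/seteqP; split => // w /= H; apply: zNE => j ji.
  by have [<- <-] := H j ji.
(* Past and future values are glued into one sequence, so that the joint event is a single event of
   [iid_pmf]. *)
pose ku j := if (j < i.+1)%N then k j else u (j - i.+1)%N.
rewrite (_ : [set w | forall j, (j <= i)%N -> _] =
    [set w | forall j, (j < i.+1)%N -> T j w = k j]); last first.
  apply/seteqP; split => w /= H j ji; first by have [] := H j ji.
  by rewrite H // zE.
rewrite iid.2 (_ : _ `&` _ =
    [set w | forall j, (j < i.+1 + m)%N -> T j w = ku j]); last first.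
  apply/seteqP; split => w /=.
    move=> [H1 H2] j jim; rewrite /ku; case: ltnP => ji; first exact: H1.
    by rewrite -[in LHS](subnKC ji) H2 // ltn_subLR.
  move=> H; split => j ji; first by rewrite H /ku ?ji ?ltn_addr.
  by rewrite H ?ltn_add2l // /ku ltnNge leq_addr /= addKn.
rewrite iid.2 big_split_ord /= -EFinM; congr (_ * _)%:E.
  by apply: eq_bigr => j _; rewrite /ku ltn_ord.
by apply: eq_bigr => j _; rewrite /ku ltnNge leq_addr /= addKn.
Qed.

Section Policy.
Variable Z : nat -> Omega -> nat.
Hypothesis causal : causal_policy P T q Z.

Lemma fibre_Z i : fibre_measurable (Z i).
Proof. exact: causal.1. Qed.

Definition hist i w : seq (nat * nat) := mkseq (fun j => (T j w, Z j w)) i.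

Lemma fibre_hist i : fibre_measurable (hist i).
Proof.
elim: i => [|i IH].
  by apply: (fibre_measurable_comp (fun=> [::]) (fibre_T 0%N)).
have -> : hist i.+1 = fun w => rcons (hist i w) (T i w, Z i w).
  by apply/funext => w; rewrite /hist mkseqS.
exact: (fibre_measurable_comp (fun c => rcons c.1 c.2)
  (fibre_measurable_pair IH (fibre_measurable_pair (fibre_T i) (fibre_Z i)))).
Qed.

(** Causality with one future transmission time. The law is written through [T 0] so that [T 0] can
    serve as the independent copy throughout. *)
Lemma hist_indep i c k :
  P ([set w | hist i w = c] `&` [set w | T i w = k]) =
  (P [set w | hist i w = c] * P [set w | T 0%N w = k])%E.
Proof.
rewrite law_T0; case: i => [|i].
  have [->|c0] := eqVneq c [::].
    rewrite (_ : [set w | _] = setT) ?setTI ?law_T0 ?probability_setT ?mul1e //.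
    exact/seteqP.
  rewrite (_ : [set w | _] = set0) ?set0I ?measure0 ?mul0e //.
  by apply/seteqP; split => // w /= h; move: c0; rewrite -h.
have [sc|sc] := eqVneq (size c) i.+1; last first.
  rewrite (_ : [set w | _] = set0) ?set0I ?measure0 ?mul0e //.
  apply/seteqP; split => // w /= h; move: sc.
  by rewrite -h size_mkseq eqxx.
have := causal.2 i 1%N (fun j => (nth (0, 0)%N c j).1)
  (fun j => (nth (0, 0)%N c j).2) (fun=> k).
rewrite big_ord_recl big_ord0 mulr1.
rewrite (_ : [set w | forall j, (j <= i)%N -> _] = [set w | hist i.+1 w = c]); last first.
  apply/seteqP; split => w /=.
    move=> H; apply: (@eq_from_nth _ (0, 0)%N); rewrite ?size_mkseq // => j ji.
    by rewrite nth_mkseq //; have [-> ->] := H j ji; case: (nth _ _ _).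
  by move=> <- j ji; rewrite nth_mkseq.
rewrite (_ : [set w | forall j, (j < 1)%N -> _] = [set w | T i.+1 w = k]) //.
apply/seteqP; split => w /=; first by move=> /(_ 0%N); rewrite addn0; apply.
by move=> H [|//] _; rewrite addn0.
Qed.

(** Decoding of a history list; beyond its length the default 0 is read, and [hist_agree] only looks
    below it. *)
Definition histT (h : seq (nat * nat)) j := (nth (0, 0)%N h j).1.
Definition histZ (h : seq (nat * nat)) j := (nth (0, 0)%N h j).2.

Lemma hist_agree N w j : (j < N)%N ->
  histT (hist N w) j = T j w /\ histZ (hist N w) j = Z j w.
Proof. by move=> jN; rewrite /histT /histZ nth_mkseq. Qed.

Lemma hist_S N i w : (i <= N)%N ->
  S_ (histT (hist N w)) (histZ (hist N w)) i = S_ (T ^~ w) (Z ^~ w) i.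
Proof. by apply: eq_S => j /(hist_agree w)[-> ->]. Qed.

Lemma hist_Delta b Delta0 N t w : (t < N)%N ->
  Delta_ b Delta0 (histT (hist N w)) (histZ (hist N w)) t =
  Delta_ b Delta0 (T ^~ w) (Z ^~ w) t.
Proof. by apply: eq_Delta => j /(hist_agree w)[-> ->]. Qed.

Lemma fibre_Delta b Delta0 t :
  fibre_measurable (fun w => Delta_ b Delta0 (T ^~ w) (Z ^~ w) t).
Proof.
under eq_fun do rewrite -(hist_Delta _ _ _ (ltnSn t)).
exact: (fibre_measurable_comp (fun h => Delta_ b Delta0 (histT h) (histZ h) t)
  (fibre_hist t.+1)).
Qed.

End Policy.
End Stochastic.

(** * Optimality of the threshold waiting time *)

Section StageCost.
Context {R : realType} {d : measure_display} {Omega : measurableType d}.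
Variable P : probability Omega R.
Variables (q : nat -> R) (T : nat -> Omega -> nat).
Hypothesis iid : iid_pmf P T q.
Local Notation E := (Rintegral P setT).
Local Notation integ f := (P.-integrable setT (EFin \o f)).
Hypothesis iT : integ (fun w => (T 0%N w)%:R).
Variables (b : nat) (p : nat -> R) (M beta : R).
Hypothesis pM : forall k, `|p k| <= M.

Definition excess k : R := p k - beta.
Definition stage_cost t z : R :=
  E (fun w => \sum_(k < z + T 0%N w) excess (t + b + k)).
(** The change in [stage_cost] caused by postponing the submission by one slot at age [x]. *)
Definition drift x : R := E (fun w => excess (x + T 0%N w)).

Lemma excess_bound k : `|excess k| <= M + `|beta|.
Proof. by rewrite (le_trans (ler_normB _ _)) // lerD2r. Qed.

Lemma sum_excess_bound a n :
  `|\sum_(k < n) excess (a + k)| <= (M + `|beta|) * n%:R.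
Proof.
rewrite (le_trans (ler_norm_sum _ _ _)) // mulr_natr.
rewrite -[in leRHS](card_ord n) -sumr_const.
by apply: ler_sum => k _; exact: excess_bound.
Qed.

Lemma integ_T0 (f : nat -> R) (A B : R) : (forall k, `|f k| <= A + B * k%:R) ->
  integ (fun w => f (T 0%N w)).
Proof.
move=> fAB; apply: (integ_discrete (fibre_T iid 0)) (fun w => fAB (T 0%N w)).
by apply: integD; [exact: integ_cst|exact: integZ].
Qed.

Lemma integ_stage a z : integ (fun w => \sum_(k < z + T 0%N w) excess (a + k)).
Proof.
apply: (integ_T0 (f := fun n => \sum_(k < z + n) excess (a + k))
  (A := (M + `|beta|) * z%:R) (B := M + `|beta|)) => k.
by rewrite -mulrDr -natrD sum_excess_bound.
Qed.

Lemma integ_p x : integ (fun w => p (x + T 0%N w)%N).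
Proof.
apply: (integ_T0 (f := fun n => p (x + n)%N) (A := M) (B := 0)) => k.
by rewrite mul0r addr0.
Qed.

Lemma driftE x : drift x = E (fun w => p (x + T 0%N w)%N) - beta.
Proof.
rewrite /drift /excess RintegralB //; [|exact: integ_p|exact: integ_cst].
by rewrite E_cst.
Qed.

Lemma stage_costS t z : stage_cost t z.+1 = stage_cost t z + drift (t + b + z).
Proof.
rewrite /stage_cost /drift -RintegralD //; first last.
- apply: (integ_T0 (f := fun n => excess (t + b + z + n)) (A := M + `|beta|) (B := 0)).
  by move=> k; rewrite mul0r addr0 excess_bound.
- exact: integ_stage.
by apply: eq_E => w; rewrite addSn big_ord_recr /= addnA.
Qed.

Lemma stage_costE t z :
  stage_cost t z = stage_cost t 0 + \sum_(k < z) drift (t + b + k).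
Proof.
elim: z => [|z IH]; first by rewrite big_ord0 addr0.
by rewrite stage_costS IH big_ord_recr addrA.
Qed.

Lemma normr_E_T0 (f : nat -> R) (A B : R) : (forall k, `|f k| <= A + B * k%:R) ->
  `|E (fun w => f (T 0%N w))| <= A + B * E (fun w => (T 0%N w)%:R).
Proof.
move=> fAB; have if_ := integ_T0 fAB.
have iAB : integ (fun w => A + B * (T 0%N w)%:R).
  by apply: integD; [exact: integ_cst|exact: integZ].
rewrite (le_trans (le_normr_Rintegral _ if_)) //.
apply: le_trans (le_E _ iAB _) _ => //; first exact: (integrable_norm if_).
by rewrite RintegralD ?E_cst ?RintegralZl //; [exact: integ_cst|exact: integZ].
Qed.

(** [gamma_] is written with [T 1] and the stage costs with [T 0]. Equality of their laws is read
    off from [hist_indep], with zero waiting as a dummy policy. *)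
Lemma E_p_T1 x : fine (Ex P (fun w => p (x + T 1%N w)%N)) =
  E (fun w => p (x + T 0%N w)%N).
Proof.
have causal := causal_fun iid (fun=> 0%N).
have [|||_ _ _ EE] := E_independent (fibre_hist iid causal 1) (fibre_T iid 1)
  (fibre_T iid 0) (hist_indep iid causal 1) (F := fun _ k => p (x + k)%N)
  (A := fun=> M) (D := fun=> 0).
- by move=> _ k; rewrite addr0.
- exact: integ_cst.
- exact: integ_cst.
by rewrite E_cst in EE; exact: EE.
Qed.

(** Multiplying the average over [tau] slots, minus [beta], by [tau] gives the sum of [tau] drifts;
    [gamma_] is the infimum of these averages. *)
Lemma gammaP x : beta <= gamma_ P p T x <->
  forall tau, (0 < tau)%N -> 0 <= \sum_(k < tau) drift (x + k).
Proof.
have driftsE tau : (0 < tau)%N -> \sum_(k < tau) drift (x + k) =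
    tau%:R * (tau%:R^-1 * \sum_(k < tau) fine (Ex P (fun w => p (x + k + T 1%N w)%N)) - beta).
  move=> tau0; rewrite mulrBr mulVKf ?pnatr_eq0 -?lt0n //.
  under eq_bigr do rewrite driftE.
  rewrite sumrB sumr_const card_ord mulr_natl; congr (_ - _).
  by apply: eq_bigr => k _; rewrite E_p_T1.
split=> [bg tau tau0|drift0].
  rewrite driftsE // mulr_ge0 // subr_ge0 (le_trans bg) //; apply: ge_inf; last by exists tau.
  (* A real infimum is a lower bound only for a set bounded below; here [- M] bounds it. *)
  exists (- M) => _ [n n0 <-].
  rewrite ler_pdivlMl ?ltr0n // mulrN mulr_natl -[n in M *+ n]card_ord -sumr_const -sumrN.
  apply: ler_sum => k _; rewrite E_p_T1.
  have bnd j : `|p (x + k + j)%N| <= M + 0 * j%:R by rewrite mul0r addr0.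
  have := normr_E_T0 (f := fun n => p (x + k + n)%N) bnd.
  by rewrite mul0r addr0 ler_norml => /andP[].
apply: lb_le_inf; first by exists (1%:R^-1 * \sum_(k < 1) fine (Ex P (fun w => p (x + k + T 1%N w)%N))), 1%N.
move=> _ [tau tau0 <-]; have := drift0 _ tau0.
by rewrite driftsE // pmulr_rge0 ?ltr0n // subr_ge0.
Qed.

Lemma thr_wait_optimal t z : (exists z0, beta <= gamma_ P p T (t + b + z0)%N) ->
  stage_cost t (thr_wait P p T b beta t) <= stage_cost t z.
Proof.
move=> exz; rewrite /thr_wait; case: pselect => // exz'.
case: ex_minnP => z0 z0P z0min.
rewrite (stage_costE t z0) (stage_costE t z) lerD2l.
have split_drift a n : \sum_(k < a + n) drift (t + b + k) =
    \sum_(k < a) drift (t + b + k) + \sum_(k < n) drift (t + b + a + k).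
  rewrite big_split_ord; congr (_ + _).
  by apply: eq_bigr => k _; rewrite /= addnA.
(* From [z0] on, [gammaP] says that no further waiting decreases the cost. *)
have after y : (z0 <= y)%N ->
    \sum_(k < z0) drift (t + b + k) <= \sum_(k < y) drift (t + b + k).
  move=> z0y; rewrite -(subnKC z0y) split_drift lerDl.
  case: (y - z0)%N => [|n]; first by rewrite big_ord0.
  by have /gammaP := z0P; apply.
have [m] := ubnP (z0 - z)%N; elim: m z => // m IH z zm.
have [/after //|zz0] := leqP z0 z.
(* Before [z0] some block of [tau] further slots has negative total drift: [z + tau] is cheaper than
   [z] and is closer to [z0] or beyond it, which drives the induction. *)
have : ~ beta <= gamma_ P p T (t + b + z)%N by move/z0min; lia.
move=> /gammaP /existsNP[tau] /not_implyP[tau0] /negP; rewrite -ltNge => neg.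
have : \sum_(k < z0) drift (t + b + k) <= \sum_(k < z + tau) drift (t + b + k).
  by apply: IH; lia.
by rewrite split_drift; lra.
Qed.

End StageCost.

(** * Cost over a finite horizon *)

Section StageDecomposition.
Context {R : realType} {d : measure_display} {Omega : measurableType d}.
Variable P : probability Omega R.
Variables (q : nat -> R) (T : nat -> Omega -> nat).
Hypothesis iid : iid_pmf P T q.
Local Notation E := (Rintegral P setT).
Local Notation integ f := (P.-integrable setT (EFin \o f)).

Lemma law_outside_support i : P [set w | q (T i w) = 0] = 0%E.
Proof.
pose D k : \bar R := ((q k == 0)%:R)%:E.
have D0 k : (0 <= D k)%E by rewrite lee_fin ler0n.
have mD : measurable [set w | q (T i w) = 0].
  exact: (fibre_measurable_set (fun k => q k = 0) (fibre_T iid i)).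
have causal := causal_fun iid (fun=> 0%N).
transitivity (\int[P]_w D (T i w))%E.
  rewrite -[X in P X]setIT -integral_indic //.
  apply: eq_integral => w _; rewrite /D indicE; congr ((nat_of_bool _)%:R%:E).
  by apply/idP/idP => [|/eqP qT]; rewrite inE /= => // ->.
rewrite (eq_law_ge0 (fibre_hist iid causal i) (fibre_T iid i) (fibre_T iid 0)
  (hist_indep iid causal i)) // (ge0_integral_discrete _ measurableT (fibre_T iid 0)) //.
apply: eseries0 => k _ _; rewrite setTI (law_T0 iid) /D.
by have [->|] := eqVneq (q k) 0; rewrite ?mule0 ?mul0e.
Qed.

Hypothesis q_ge0 : forall k, 0 <= q k.

(** One null set serves all indices. Off it every [T i] is a possible value, hence positive and
    covered by the threshold clause of [beta_root]. *)
Lemma ae_support : exists N, [/\ measurable N, P N = 0%E &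
  forall w, ~ N w -> forall i, 0 < q (T i w)].
Proof.
have : P.-negligible (\bigcup_i [set w | q (T i w) = 0]).
  apply: negligible_bigcup => i; exists [set w | q (T i w) = 0]; split=> //.
    exact: (fibre_measurable_set (fun k => q k = 0) (fibre_T iid i)).
  exact: law_outside_support.
move=> [N [mN PN subN]]; exists N; split=> // w Nw i.
rewrite lt_neqAle q_ge0 andbT; apply/eqP => qT; apply: Nw; apply: subN.
by exists i.
Qed.

Hypothesis q0 : q 0%N = 0.

Lemma support_gt0 w : (forall i, 0 < q (T i w)) -> forall i, (0 < T i w)%N.
Proof. by move=> qT i; rewrite lt0n; apply/eqP => T0; have := qT i; rewrite T0 q0 ltxx. Qed.

Hypothesis iT : integ (fun w => (T 0%N w)%:R).
Variables (b Delta0 : nat) (p : nat -> R) (M beta : R).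
Hypothesis pM : forall k, `|p k| <= M.
Local Notation C := (M + `|beta|).
Local Notation excess := (excess p beta).
Local Notation scost := (stage_cost P T b p beta).

Section Policy.
Variable Z : nat -> Omega -> nat.
Hypothesis causal : causal_policy P T q Z.
Local Notation S i w := (S_ (T ^~ w) (Z ^~ w) i).

(** [S_ i] is a function of the history before [T i], so [T i] can be replaced by an independent
    copy with [S_ i] held fixed. *)
Lemma E_submission i (F : nat -> nat -> R) (D : nat -> R) :
  (forall s k, `|F s k| <= D k) -> integ (fun w => D (T 0%N w)) ->
  [/\ integ (fun w => F (S i w) (T i w)),
      integ (fun w => E (fun w' => F (S i w) (T 0%N w'))) &
      E (fun w => F (S i w) (T i w)) = E (fun w => E (fun w' => F (S i w) (T 0%N w')))].
Proof.
move=> FD iD.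
have [||| iF _ iF0 EF] := E_independent (fibre_hist iid causal i) (fibre_T iid i)
  (fibre_T iid 0) (hist_indep iid causal i)
  (F := fun h k => F (S_ (histT h) (histZ h) i) k) (A := fun=> 0) (D := D).
- by move=> h k; rewrite add0r.
- exact: integ_cst.
- by [].
have SE w : S_ (histT (hist T Z i w)) (histZ (hist T Z i w)) i = S i w.
  exact: hist_S.
split.
- by apply: eq_integ iF => w; rewrite SE.
- by apply: eq_integ iF0 => w; rewrite SE.
- transitivity (E (fun w => F (S_ (histT (hist T Z i w)) (histZ (hist T Z i w)) i) (T i w))).
    by apply: eq_E => w; rewrite SE.
  by rewrite EF; apply: eq_E => w; rewrite SE.
Qed.

Lemma integ_law i (f : nat -> R) : integ (fun w => f (T 0%N w)) -> integ (fun w => f (T i w)).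
Proof.
exact: (integ_eq_law (fibre_hist iid causal i) (fibre_T iid i) (fibre_T iid 0)
  (hist_indep iid causal i)).
Qed.

(** * Stages submitted before a horizon *)

Section Horizon.
(** [W s t z] is the wait charged to a stage with submission time [s], transmission time [t] and
    actual wait [z]; [om] dominates it, and [e] bounds the end of the straddling stage. This covers
    both cut-off and full waits. *)
Variables (n : nat) (W : nat -> nat -> nat -> nat) (e om : nat -> nat).
Hypothesis iom : integ (fun w => (om (T 0%N w))%:R).
Hypothesis ie : integ (fun w => (e (T 0%N w))%:R).
Hypothesis Wom : forall s t z, (s < n)%N -> (W s t z <= om t)%N.
Local Notation Wc i w := (W (S i w) (T i w) (Z i w)).

(** [S_ i], [T i] and [Z i] belong to the history before [T i.+1]; integrating [T i.+1] out of the
    cycle leaves [stage_cost]. The indicator restricts to [s < n], where [om] dominates the wait. *)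
Lemma E_partial_cycle i :
  let cyc w := (S i w < n)%:R * partial_cycle (T ^~ w) b excess i (Wc i w) in
  let stage w := (S i w < n)%:R * scost (T i w) (Wc i w) in
  [/\ integ cyc, integ stage & E cyc = E stage].
Proof.
move=> cyc stage.
pose Sh h := S_ (histT h) (histZ h) i.
pose Wh h := W (Sh h) (histT h i) (histZ h i).
pose F h k : R := (Sh h < n)%:R *
  \sum_(j < Wh h + k) excess (histT h i + b + j).
have [||| iF iF0 iEF EF] := E_independent (fibre_hist iid causal i.+1) (fibre_T iid i.+1)
  (fibre_T iid 0) (hist_indep iid causal i.+1)
  (F := F) (A := fun h => C * (om (histT h i))%:R) (D := fun k => C * k%:R).
- move=> h k; rewrite /F; have C0 : 0 <= C by apply: le_trans (excess_bound beta pM 0).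
  case: ltnP => Sn; last by rewrite mul0r normr0 addr_ge0 // mulr_ge0.
  rewrite mul1r (le_trans (sum_excess_bound _ pM _ _)) // -mulrDr ler_wpM2l //.
  by rewrite -natrD ler_nat leq_add2r Wom.
- apply: eq_integ (integZ C (integ_law i (f := fun k => (om k)%:R) iom)) => w.
  by have [-> _] := hist_agree T Z w (ltnSn i).
- exact: integZ.
have ShE w : Sh (hist T Z i.+1 w) = S i w by apply: hist_S.
have [TE ZE] : (forall w, histT (hist T Z i.+1 w) i = T i w) /\
    (forall w, histZ (hist T Z i.+1 w) i = Z i w).
  by split=> w; have [] := hist_agree T Z w (ltnSn i).
have FE w k : F (hist T Z i.+1 w) k = (S i w < n)%:R *
    \sum_(j < Wc i w + k) excess (T i w + b + j).
  by rewrite /F /Wh ShE TE ZE.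
have cycE : cyc =1 fun w => F (hist T Z i.+1 w) (T i.+1 w) by move=> w; rewrite FE.
have stageE : (fun w => E (fun w' => F (hist T Z i.+1 w) (T 0%N w'))) =1 stage.
  move=> w; rewrite /stage /stage_cost -RintegralZl //; last exact: (integ_stage iid iT _ pM).
  by apply: eq_E => w'; rewrite FE.
split.
- by apply: eq_integ iF => w; rewrite cycE.
- exact: eq_integ stageE iEF.
- by rewrite (eq_E P cycE) EF (eq_E P stageE).
Qed.

(** [S_ i.+1] is decided before [T i.+1] is drawn, so straddling the horizon is independent of
    [T i.+1]. *)
Lemma E_last_transmission i :
  let last w : R := (S i w < n <= S i.+1 w)%:R in
  [/\ integ last, integ (fun w => last w * (T i.+1 w)%:R) &
      E (fun w => last w * (T i.+1 w)%:R) = E last * E (fun w => (T 0%N w)%:R)].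
Proof.
move=> last.
pose F h k : R := (S_ (histT h) (histZ h) i < n <= S_ (histT h) (histZ h) i.+1)%:R * k%:R.
have [||| iF iF0 iEF EF] := E_independent (fibre_hist iid causal i.+1) (fibre_T iid i.+1)
  (fibre_T iid 0) (hist_indep iid causal i.+1)
  (F := F) (A := fun=> 0) (D := fun k => k%:R).
- by move=> h k; rewrite /F add0r; case: (_ && _); rewrite ?mul1r ?mul0r ?normr0 ?normr_nat.
- exact: integ_cst.
- by [].
have FE w k : F (hist T Z i.+1 w) k = last w * k%:R.
  by rewrite /F !hist_S.
have il : integ last.
  pose L h : R := (S_ (histT h) (histZ h) i < n <= S_ (histT h) (histZ h) i.+1)%:R.
  suff : integ (fun w => L (hist T Z i.+1 w)) by apply: eq_integ => w; rewrite /L !hist_S.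
  apply: (integ_discrete (f := L) (g := fun=> 1) (fibre_hist iid causal i.+1)).
    exact: integ_cst.
  by move=> w; rewrite /L; case: (_ && _); rewrite ?normr1 ?normr0.
split=> //.
- by apply: eq_integ iF => w; rewrite FE.
- transitivity (E (fun w => F (hist T Z i.+1 w) (T i.+1 w))).
    by apply: eq_E => w; rewrite FE.
  rewrite EF -RintegralZr //; apply: eq_E => w.
  by rewrite -RintegralZl //; apply: eq_E => w'; rewrite FE.
Qed.

Let phi m : R := E (fun w => (e (T 0%N w) - m)%:R).

Lemma phi_ge0 m : 0 <= phi m.
Proof. by apply: Rintegral_ge0 => w. Qed.

Lemma integ_residual m : integ (fun w => (e (T 0%N w) - m)%:R).
Proof.
apply: (integ_discrete (f := fun k => (e k - m)%:R) (fibre_T iid 0) ie) => w.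
by rewrite normr_nat ler_nat leq_subr.
Qed.

Lemma phi_dec m : phi m.+1 <= phi m.
Proof.
by apply: le_E => [||w]; [exact: integ_residual..|rewrite ler_nat leq_sub2l].
Qed.

Lemma E_residual i :
  [/\ integ (fun w => (S i w < n)%:R * (e (T i w) - (n - S i w))%:R),
      integ (fun w => (S i w < n)%:R * phi (n - S i w)%N) &
      E (fun w => (S i w < n)%:R * (e (T i w) - (n - S i w))%:R) =
      E (fun w => (S i w < n)%:R * phi (n - S i w)%N)].
Proof.
have [s k||iF iEF EF] := @E_submission i
  (fun s k => (s < n)%:R * (e k - (n - s))%:R) (fun k => (e k)%:R).
- case: ltnP => _; rewrite ?mul1r ?mul0r ?normr0 ?normr_nat //.
  by rewrite ler_nat leq_subr.
- exact: ie.
have phiE : (fun w => E (fun w' => (S i w < n)%:R * (e (T 0%N w') - (n - S i w))%:R))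
    =1 (fun w => (S i w < n)%:R * phi (n - S i w)%N).
  by move=> w; rewrite RintegralZl //; exact: integ_residual.
split=> //; first exact: eq_integ phiE iEF.
by rewrite EF (eq_E P phiE).
Qed.

Lemma integ_cost (r : nat -> R) (A : R) N : (forall k, `|r k| <= A) ->
  integ (fun w => \sum_(t < N) r (Delta_ b Delta0 (T ^~ w) (Z ^~ w) t)).
Proof.
move=> rA; apply: integ_sum => t.
apply: (integ_discrete (f := r) (fibre_Delta iid causal b Delta0 t) (integ_cst P A)) => w.
exact: rA.
Qed.

Hypothesis n_gt0 : (0 < n)%N.
Hypothesis WZ : forall i w, (Wc i w <= Z i w)%N.
Hypothesis WE : forall i w, (S i.+1 w < n)%N -> Wc i w = Z i w.
Hypothesis We : forall i w, (S i w < n <= S i.+1 w)%N ->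
  (n <= S i w + T i w + Wc i w <= n + (e (T i w) - (n - S i w)))%N.

Lemma cost_vs_stages :
  `|E (fun w => \sum_(t < n) excess (Delta_ b Delta0 (T ^~ w) (Z ^~ w) t))
    - \sum_(i < n) E (fun w => (S i w < n)%:R * scost (T i w) (Wc i w))|
  <= C * (E (fun w => (T 0%N w)%:R) *+ 2 + \sum_(0 <= m < n) phi m).
Proof.
have rC := excess_bound beta pM.
have C0 : 0 <= C by apply: le_trans (rC 0%N).
have [N [mN PN suppN]] := ae_support.
pose cost w := \sum_(t < n) excess (Delta_ b Delta0 (T ^~ w) (Z ^~ w) t).
pose cyc i w := (S i w < n)%:R * partial_cycle (T ^~ w) b excess i (Wc i w).
pose last i w : R := (S i w < n <= S i.+1 w)%:R.
pose res i w : R := (S i w < n)%:R * (e (T i w) - (n - S i w))%:R.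
pose res' i w : R := (S i w < n)%:R * phi (n - S i w)%N.
have icost : integ cost by exact: integ_cost rC.
have icyc i : integ (cyc i) by have [] := E_partial_cycle i.
have icycs : integ (fun w => \sum_(i < n) cyc i w) by apply: integ_sum => i.
have ilast i : integ (last i) by have [] := E_last_transmission i.
have ilastT i : integ (fun w => last i w * (T i.+1 w)%:R).
  by have [] := E_last_transmission i.
have ires i : integ (res i) by have [] := E_residual i.
have ires' i : integ (res' i) by have [] := E_residual i.
have ilastTs : integ (fun w => \sum_(i < n) last i w * (T i.+1 w)%:R).
  by apply: integ_sum => i.
have iress : integ (fun w => \sum_(i < n) res i w) by apply: integ_sum => i.
pose err w := (T 0%N w)%:R + \sum_(i < n) last i w * (T i.+1 w)%:R + \sum_(i < n) res i w.
have iTlast : integ (fun w => (T 0%N w)%:R + \sum_(i < n) last i w * (T i.+1 w)%:R).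
  exact: integD.
have ierr : integ err by exact: integD.
have diffE : E cost - \sum_(i < n) E (fun w => (S i w < n)%:R * scost (T i w) (Wc i w))
    = E (fun w => cost w - \sum_(i < n) cyc i w).
  rewrite RintegralB // [X in _ = _ - X]E_sum //; congr (_ - _); apply: eq_bigr => i _.
  by have [_ _ ->] := E_partial_cycle i.
rewrite diffE.
have idiff : integ (fun w => cost w - \sum_(i < n) cyc i w) by exact: integB.
(* The path estimate needs positive transmission times, so it is available off the null set only. *)
have errP w : ~ N w -> `|cost w - \sum_(i < n) cyc i w| <= C * err w.
  move=> /suppN /support_gt0 Tpos.
  exact: (cost_vs_cycles b Delta0 (e := fun i => e (T i w)) Tpos rC n_gt0
    (fun i => WZ i w) (fun i => @WE i w) (fun i => @We i w)).
apply: (@le_trans _ _ (E (fun w => C * err w))).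
  have iCerr : integ (fun w => C * err w) by exact: integZ.
  have errU w : ~ N w -> cost w - \sum_(i < n) cyc i w <= C * err w.
    by move=> /errP; rewrite ler_norml => /andP[].
  have errL w : ~ N w -> -1 * (C * err w) <= cost w - \sum_(i < n) cyc i w.
    by move=> /errP; rewrite ler_norml mulN1r => /andP[].
  rewrite ler_norml (le_E_ae mN PN idiff iCerr errU) andbT.
  rewrite -mulN1r -RintegralZl //.
  exact: (le_E_ae mN PN (integZ (-1) iCerr) idiff errL).
rewrite RintegralZl // ler_wpM2l // /err RintegralD // RintegralD // !E_sum //.
rewrite mulr2n -addrA -[leRHS]addrA lerD2l lerD //.
  (* The straddling indicators sum to at most 1, so these terms contribute at most one more mean
     transmission time. *)
  rewrite (eq_bigr (fun i : 'I_n => E (last i) * E (fun w => (T 0%N w)%:R))); last first.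
    by move=> i _; have [_ _ ->] := E_last_transmission i.
  rewrite -mulr_suml ler_piMl //; first by apply: Rintegral_ge0 => w.
  rewrite -E_sum // -[leRHS](E_cst P 1); apply: le_E => [||w].
  - by apply: integ_sum => i; exact: ilast.
  - exact: integ_cst.
  - exact: sum_last_submission.
(* After averaging over [T i], [sum_residual] applies pathwise to the decreasing function [phi]. *)
rewrite (eq_bigr (fun i : 'I_n => E (res' i))); last first.
  by move=> i _; have [_ _ ->] := E_residual i.
rewrite -E_sum // -[leRHS](E_cst P); have iress' : integ (fun w => \sum_(i < n) res' i w) by apply: integ_sum => i.
apply: (le_E_ae mN PN iress' (integ_cst P _) _) => w /suppN /support_gt0 Tpos.
exact: (sum_residual (Z ^~ w) Tpos n n phi_ge0 phi_dec).
Qed.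

End Horizon.
End Policy.
End StageDecomposition.

(** * Long-run average cost *)

Lemma le_limn_esup (R : realType) (u v : (\bar R)^nat) :
  (forall n, u n <= v n)%E -> (limn_esup u <= limn_esup v)%E.
Proof.
move=> uv; rewrite !limn_esup_lim; apply: lee_lim; [exact: is_cvg_esups..|].
apply: nearW => n; apply: ge_ereal_sup => _ [k nk <-].
by apply: le_ereal_sup_tmp; exists (v k) => //; exists k.
Qed.

Section Optimality.
Context {R : realType} {d : measure_display} {Omega : measurableType d}.
Variable P : probability Omega R.
Variables (q : nat -> R) (T : nat -> Omega -> nat).
Local Notation E := (Rintegral P setT).
Local Notation integ f := (P.-integrable setT (EFin \o f)).
Hypothesis q_ge0 : forall k, 0 <= q k.
Hypothesis q0 : q 0%N = 0.
Hypothesis iid : iid_pmf P T q.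
Hypothesis iT : integ (fun w => (T 0%N w)%:R).
Variables (b Delta0 : nat) (p : nat -> R) (M beta : R).
Hypothesis pM : forall k, `|p k| <= M.
Hypothesis root : beta_root P q p T b Delta0 beta.
Local Notation C := (M + `|beta|).
Local Notation excess := (excess p beta).
Local Notation thr := (thr_wait P p T b beta).
Local Notation Zthr := (thr_policy P p T b beta).

(** By [thr_wait_optimal], this is the minimum of the stage cost over all waits for every [t] in the
    support of [q]. *)
Definition thr_cost t := stage_cost P T b p beta t (thr t).

Lemma causal_thr : causal_policy P T q Zthr.
Proof. exact: (causal_fun iid (thr_wait P p T b beta)). Qed.

Lemma cycle_lenE i w : cycle_len P p T b beta i w = (thr (T i w) + T i.+1 w)%:R.
Proof. by rewrite /cycle_len D_succ addKn. Qed.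

Lemma integ_thr : integ (fun w => (thr (T 0%N w))%:R).
Proof.
have [_ ilen _] := root.
apply: (integ_discrete (f := fun k => (thr k)%:R) (fibre_T iid 0) (ilen 0%N)) => w.
by rewrite cycle_lenE normr_nat ler_nat leq_addr.
Qed.

Lemma E_thr_cost : integ (fun w => thr_cost (T 0%N w)) /\
  E (fun w => thr_cost (T 0%N w)) = 0.
Proof.
have [_ ilen eq0] := root.
(* As [S_ 0 = 0], horizon 1 with index 0 makes the indicator equal to 1 and yields the bare first
   cycle. *)
have [//|icyc istage Ecyc] := E_partial_cycle iid iT b beta pM causal_thr
  (n := 1) (W := fun _ t _ => thr t) (om := thr) integ_thr _ 0.
have stageE : (fun w => (S_ (T ^~ w) (Zthr ^~ w) 0 < 1)%:R *
    stage_cost P T b p beta (T 0%N w) (thr (T 0%N w))) =1 (fun w => thr_cost (T 0%N w)).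
  by move=> w; rewrite /= mul1r.
have cycE w : (S_ (T ^~ w) (Zthr ^~ w) 0 < 1)%:R *
    partial_cycle (T ^~ w) b excess 0 (thr (T 0%N w)) =
    cycle_cost P p T b Delta0 beta 0 w - beta * cycle_len P p T b beta 0 w.
  rewrite /= mul1r -(@partial_cycleE (T ^~ w) (Zthr ^~ w) _ b Delta0 excess 0) //.
  rewrite /cycle_cost D_succ sumrB sumr_const_nat addKn cycle_lenE.
  by rewrite mulr_natr.
split; first exact: eq_integ stageE istage.
rewrite -(eq_E P stageE) -Ecyc (eq_E P cycE).
have iblen : integ (fun w => beta * cycle_len P p T b beta 0 w) by exact: (integZ beta (ilen 0%N)).
(* [beta_root] grants integrability of the cycle length only; that of the cycle cost is recovered
   from the excess cost. *)
have icost : integ (cycle_cost P p T b Delta0 beta 0).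
  by apply: eq_integ (integD (eq_integ cycE icyc) iblen) => w; exact: subrK.
rewrite RintegralB // RintegralZl //; [exact: (eq0 0%N)|exact: (ilen 0%N)].
Qed.

(** Whatever the policy, [T i] is independent of [S_ i], so the zero mean of [thr_cost] survives the
    restriction to stages submitted before [n]. *)
Lemma E_submission_thr_cost Z : causal_policy P T q Z -> forall n i,
  let F w := (S_ (T ^~ w) (Z ^~ w) i < n)%:R * thr_cost (T i w) in
  integ F /\ E F = 0.
Proof.
move=> causal n i F; have [ig Eg] := E_thr_cost.
have [||iF _ EF] := @E_submission _ _ _ P q T iid Z causal i
  (fun s k => (s < n)%:R * thr_cost k) (fun k => `|thr_cost k|).
- by move=> s k; case: ltnP => _; rewrite ?mul1r ?mul0r ?normr0.
- exact: (integrable_norm ig).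
split=> //; rewrite EF -[RHS](E_cst P); apply: eq_E => w.
by rewrite RintegralZl // Eg mulr0.
Qed.

Lemma causal_policy_cost_ge Z n : causal_policy P T q Z -> (0 < n)%N ->
  - (C * (E (fun w => (T 0%N w)%:R) *+ 2 + \sum_(0 <= m < n) E (fun w => (T 0%N w - m)%:R)))
  <= E (fun w => \sum_(t < n) excess (Delta_ b Delta0 (T ^~ w) (Z ^~ w) t)).
Proof.
move=> causal n0.
(* The wait stops at slot [n], so it is at most [n], hence integrable. The straddling stage then
   ends at the larger of [n] and [s + t], which is why [e] can be the identity below. *)
pose W s t z := minn z (n - (s + t)).
have iom : integ (fun w => n%:R) by exact: integ_cst.
have Wom s t z : (s < n)%N -> (W s t z <= n)%N.
  by move=> _; rewrite (leq_trans (geq_minr _ _)) // leq_subr.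
have WZ i w : (W (S_ (T ^~ w) (Z ^~ w) i) (T i w) (Z i w) <= Z i w)%N by exact: geq_minl.
have WE i w : (S_ (T ^~ w) (Z ^~ w) i.+1 < n)%N ->
    W (S_ (T ^~ w) (Z ^~ w) i) (T i w) (Z i w) = Z i w.
  by rewrite /= /W => Sn; apply/minn_idPl; lia.
have We i w : (S_ (T ^~ w) (Z ^~ w) i < n <= S_ (T ^~ w) (Z ^~ w) i.+1)%N ->
    (n <= S_ (T ^~ w) (Z ^~ w) i + T i w + W (S_ (T ^~ w) (Z ^~ w) i) (T i w) (Z i w)
       <= n + (T i w - (n - S_ (T ^~ w) (Z ^~ w) i)))%N.
  by rewrite /= /W; lia.
have := cost_vs_stages iid q_ge0 q0 iT b Delta0 beta pM causal
  (e := id) iom iT Wom n0 WZ WE We.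
have : 0 <= \sum_(i < n) E (fun w => (S_ (T ^~ w) (Z ^~ w) i < n)%:R *
    stage_cost P T b p beta (T i w) (W (S_ (T ^~ w) (Z ^~ w) i) (T i w) (Z i w))).
  (* Almost surely each cut-off wait costs at least [thr_cost], whose restricted mean is zero. *)
  apply: sumr_ge0 => i _; have [iF EF] := E_submission_thr_cost causal n i.
  have [_ istage _] := E_partial_cycle iid iT b beta pM causal iom Wom i.
  have [N [mN PN suppN]] := ae_support iid q_ge0.
  rewrite -EF; apply: (le_E_ae mN PN iF istage _) => w /suppN qT.
  rewrite ler_wpM2l //; apply: (thr_wait_optimal iid iT pM).
  by have [ex _ _] := root; exact: ex.
by rewrite ler_norml; set X := \sum_(i < n) _; move=> X0 /andP[+ _]; lra.
Qed.

(** Threshold waits are integrable, so no cut-off is needed: [e] is the transmission time plus the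
    full wait, and every stage term has mean exactly zero. *)
Lemma thr_policy_cost_le n : (0 < n)%N ->
  `|E (fun w => \sum_(t < n) excess (Delta_ b Delta0 (T ^~ w) (Zthr ^~ w) t))| <=
  C * (E (fun w => (T 0%N w)%:R) *+ 2 +
       \sum_(0 <= m < n) E (fun w => (T 0%N w + thr (T 0%N w) - m)%:R)).
Proof.
move=> n0.
have ie : integ (fun w => (T 0%N w + thr (T 0%N w))%:R).
  by apply: eq_integ (integD iT integ_thr) => w; rewrite natrD.
have := cost_vs_stages iid q_ge0 q0 iT b Delta0 beta pM causal_thr
  (W := fun _ t _ => thr t) (e := fun t => (t + thr t)%N) integ_thr ie
  (fun _ _ _ _ => leqnn _) n0 (fun _ _ => leqnn _) (fun _ _ _ => erefl).
rewrite big1 ?subr0 => [|i _]; last first.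
  by have [_ EF] := E_submission_thr_cost causal_thr n i.
by apply=> i w /=; rewrite /thr_policy; lia.
Qed.

Lemma avg_costE Z : causal_policy P T q Z ->
  avg_cost P p b Delta0 T Z = limn_esup (fun n => (n%:R^-1 * (n%:R * beta +
    E (fun w => \sum_(t < n) excess (Delta_ b Delta0 (T ^~ w) (Z ^~ w) t))))%:E).
Proof.
move=> causal; rewrite /avg_cost; congr limn_esup; apply/funext => n.
rewrite /Ex (E_EFin (integ_cost iid b Delta0 causal n pM)) -EFinM; congr (_ * _)%:E.
rewrite -[n%:R * beta](E_cst P) -RintegralD //; last 2 first.
- exact: integ_cst.
- exact: (integ_cost iid b Delta0 causal n (excess_bound beta pM)).
apply: eq_E => w; rewrite sumrB sumr_const card_ord -[beta *+ n]mulr_natl.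
by rewrite [RHS]addrC subrK.
Qed.

(** The sign [s] lets one statement serve the lower bound for all policies and the upper bound for
    the threshold policy. *)
Lemma cvg_error (L : Omega -> nat) (K : R) (s : bool) :
  fibre_measurable L -> integ (fun w => (L w)%:R) ->
  (n%:R^-1 * (n%:R * beta + (-1) ^+ s * (C * (K +
     \sum_(0 <= m < n) E (fun w => (L w - m)%:R)))))%:E @[n --> \oo] --> beta%:E.
Proof.
move=> mL iL; apply: cvg_EFin; first exact: nearW.
have inv0 : (n%:R^-1 : R) @[n --> \oo] --> 0.
  by rewrite -cvg_shiftS; exact: cvg_harmonic.
have : (beta + (-1) ^+ s * C * (n%:R^-1 * K +
    n%:R^-1 * \sum_(0 <= m < n) E (fun w => (L w - m)%:R))) @[n --> \oo] -->
    beta + (-1) ^+ s * C * (0 * K + 0).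
  apply: cvgD; first exact: cvg_cst.
  apply: cvgM; first exact: cvg_cst.
  apply: cvgD (cvg_mean_E_subn mL iL).
  by apply: cvgM => //; exact: cvg_cst.
rewrite mul0r addr0 mulr0 addr0; apply: cvg_trans; apply: near_eq_cvg.
near=> n.
have n0 : n%:R != 0 :> R by rewrite pnatr_eq0 -lt0n; near: n; exists 1%N.
rewrite /=; field; exact: n0.
Unshelve. all: by end_near. Qed.

Lemma avg_cost_ge Z : causal_policy P T q Z -> (beta%:E <= avg_cost P p b Delta0 T Z)%E.
Proof.
move=> causal; rewrite avg_costE //.
have [_ <-] := cvg_limn_einf_sup
  (cvg_error (E (fun w => (T 0%N w)%:R) *+ 2) true (fibre_T iid 0) iT).
(* At [n = 0] the inverse is 0 by convention and both sides vanish. *)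
apply: le_limn_esup => -[|n]; first by rewrite invr0 !mul0r.
rewrite lee_fin ler_pM2l ?invr_gt0 ?ltr0n // lerD2l expr1 mulN1r.
exact: causal_policy_cost_ge.
Qed.

Lemma avg_cost_thr : avg_cost P p b Delta0 T Zthr = beta%:E.
Proof.
apply/eqP; rewrite eq_le avg_cost_ge ?andbT; last exact: causal_thr.
rewrite avg_costE; last exact: causal_thr.
have ie : integ (fun w => (T 0%N w + thr (T 0%N w))%:R).
  by apply: eq_integ (integD iT integ_thr) => w; rewrite natrD.
have [_ <-] := cvg_limn_einf_sup (cvg_error (E (fun w => (T 0%N w)%:R) *+ 2) false
  (fibre_measurable_comp (fun t => (t + thr t)%N) (fibre_T iid 0)) ie).
apply: le_limn_esup => -[|n]; first by rewrite invr0 !mul0r.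
rewrite lee_fin ler_pM2l ?invr_gt0 ?ltr0n // lerD2l expr0 mul1r.
exact: le_trans (ler_norm _) (thr_policy_cost_le _).
Qed.

Lemma pbar_optE : pbar_opt P q p b Delta0 T = beta%:E.
Proof.
apply/eqP; rewrite eq_le; apply/andP; split.
  by rewrite -avg_cost_thr; apply: ereal_inf_lbound; exists Zthr => //; exact: causal_thr.
by apply: le_ereal_inf_tmp => _ [Z causal <-]; exact: avg_cost_ge.
Qed.

Lemma root_ratio i :
  beta = fine (Ex P (cycle_cost P p T b Delta0 beta i))
         / fine (Ex P (cycle_len P p T b beta i)).
Proof.
have [_ ilen eq0] := root.
(* A cycle contains a transmission, which almost surely lasts at least one slot, so the division is
   legitimate. *)
have len_gt0 : 0 < fine (Ex P (cycle_len P p T b beta i)).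
  apply: (@lt_le_trans _ _ 1) => //.
  have [N [mN PN suppN]] := ae_support iid q_ge0.
  rewrite -[leLHS](E_cst P); apply: (le_E_ae mN PN (integ_cst P _) (ilen i) _).
  move=> w /suppN qT; rewrite cycle_lenE ler1n.
by apply: ltn_addl; exact: (support_gt0 q0 qT).
have /eqP := eq0 i; rewrite subr_eq0 => /eqP ->.
by rewrite mulfK // gt_eqF.
Qed.

End Optimality.

Theorem theorem4 (R : realType) (d : measure_display) (Omega : measurableType d)
  (P : probability Omega R) (q : nat -> R) (T : nat -> Omega -> nat)
  (B b : nat) (Delta0 : nat) (p : nat -> R) (M : R) (beta_b : R) :
  (forall k, 0 <= q k) -> q 0%N = 0 ->
  iid_pmf P T q ->
  P.-integrable setT (fun w => (T 0%N w)%:R%:E) ->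
  (b < B)%N ->
  (forall delta, `|p delta| <= M) ->
  beta_root P q p T b Delta0 beta_b ->
  (forall beta, beta_root P q p T b Delta0 beta -> beta = beta_b) ->
  [/\ causal_policy P T q (thr_policy P p T b beta_b),
      avg_cost P p b Delta0 T (thr_policy P p T b beta_b) = pbar_opt P q p b Delta0 T,
      forall i, pbar_opt P q p b Delta0 T =
        (fine (Ex P (cycle_cost P p T b Delta0 beta_b i))
         / fine (Ex P (cycle_len P p T b beta_b i)))%:E
    & pbar_opt P q p b Delta0 T = beta_b%:E].
Proof.
move=> q_ge0 q0 iid iT _ pM root _.
rewrite (pbar_optE q_ge0 q0 iid iT pM root); split=> [||i|//].
- exact: causal_thr.
- exact: avg_cost_thr pM root.
- by congr EFin; exact: root_ratio.
Qed.
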